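(* Let $a,b,c,d,e,f\in\mathbb{Z}$ satisfy $$\begin{cases} acdf-abd-ace-bcf-def+a^2+b^2+c^2+d^2+e^2+f^2=0\\ af-be+cd=0\end{cases}$$ and let $$M=\begin{bmatrix}1&a&b&c\\0&1&d&e\\0&0&1&f\\0&0&0&1\end{bmatrix}.$$ Then under the action of the signed braid group $\Sigma B_4$, $M$ is equivalent to (i.e. lies in the same orbit as) exactly one of the following matrices: $$\begin{bmatrix}1&2&2&4\\0&1&0&2\\0&0&1&2\\0&0&0&1\end{bmatrix},\qquad\qquad \begin{bmatrix}1&n&2n&n\\0&1&3&3\\0&0&1&3\\0&0&0&1\end{bmatrix}\quad\text{for } n\in\mathbb{N}.$$
   Context: $\mathbb{N}$ includes $0$. The braid group $B_4$, generated by $\sigma_1,\sigma_2,\sigma_3$, and the group $(\mathbb{Z}/2\mathbb{Z})^4$, generated by $\epsilon_1,\dots,\epsilon_4$, together generate the signed braid group $\Sigma B_4=B_4\ltimes(\mathbb{Z}/2\mathbb{Z})^4$ (where $B_4$ acts on $(\mathbb{Z}/2\mathbb{Z})^4$ through its quotient $S_4$). It acts on the set of upper triangular integer $4\times4$ matrices with $1$'s on the diagonal. Such a matrix is viewed as the Gram matrix $M_{kl}=\langle e_k,e_l\rangle$ of a bilinear form with respect to a basis $(e_1,\dots,e_4)$ satisfying $\langle e_i,e_i\rangle=1$ and $\langle e_i,e_j\rangle=0$ for $j<i$. The generators act on such bases as follows: $\sigma_i$ replaces $(e_i,e_{i+1})$ by $(e_{i+1}-\langle e_i,e_{i+1}\rangle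 e_i,\ e_i)$ and $\epsilon_i$ replaces $e_i$ by $-e_i$; $\sigma(M)$ denotes the Gram matrix of the transformed basis. Explicitly, for $k<l$: $$\sigma_i(M)_{kl}=\begin{cases}M_{kl}&\text{if }\{k,l\}\cap\{i,i+1\}=\emptyset\\ M_{k,i+1}-M_{i,i+1}M_{ki}&\text{if }l=i\\ M_{k,i}&\text{if }l=i+1,\ k\ne i\\ M_{i+1,l}-M_{i,i+1}M_{il}&\text{if }k=i,\ l\ne i+1\\ M_{i,l}&\text{if }k=i+1\\ -M_{i,i+1}&\text{if }k=i,\ l=i+1\end{cases}$$ and $\epsilon_i(M)_{kl}=-M_{kl}$ if $i\in\{k,l\}$, $\epsilon_i(M)_{kl}=M_{kl}$ otherwise.
   Formalization: The case a=b=c=d=e=f=0 is excluded: both equations then hold, but M is the identity matrix, which is fixed by the whole signed braid group and is not among the listed matrices. *)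

(* Defs.v *)
From HB Require Import structures.
From mathcomp Require Import all_boot all_order all_algebra all_fingroup.
From mathcomp Require Import boolp ring.
From mathcomp Require Import generic_quotient.

Set Implicit Arguments.
Unset Strict Implicit.
Unset Printing Implicit Defensive.

Import GRing.Theory.
Local Open Scope ring_scope.
Local Open Scope quotient_scope.

(* All indices are shifted down by one: the generators sigma_1, sigma_2,      *)
(* sigma_3 are indexed by 'I_3 and the basis vectors e_1, ..., e_4 by 'I_4.   *)
(* The two strands exchanged by sigma_i are lo i and hi i.                    *)
Definition lo (i : 'I_3) : 'I_4 := widen_ord (leqnSn 3) i.
Definition hi (i : 'I_3) : 'I_4 := lift ord0 i.

(* The signed braid group B_4 |x (Z/2Z)^4, as the quotient of the words in    *)
(* the generators and their formal inverses by the congruence sb_eq. The      *)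
(* relations are the braid relations, those of (Z/2Z)^4, and the ones         *)
(* expressing that sigma_i permutes the epsilon_j by the transposition        *)
(* (i i+1).                                                                   *)

(* inl i is sigma_i and inr j is epsilon_j; in a word, (x, false) stands for  *)
(* x and (x, true) for its inverse.                                           *)
Definition sb_gen : Type := ('I_3 + 'I_4)%type.
Definition sb_word : Type := seq (sb_gen * bool).

Definition sig (i : 'I_3) : sb_gen * bool := (inl i, false).
Definition eps (j : 'I_4) : sb_gen * bool := (inr j, false).

Inductive sb_eq : sb_word -> sb_word -> Prop :=
| sb_refl w : sb_eq w w
| sb_sym u v : sb_eq u v -> sb_eq v u
| sb_trans u v w : sb_eq u v -> sb_eq v w -> sb_eq u w
| sb_cat u u' v v' : sb_eq u u' -> sb_eq v v' -> sb_eq (u ++ v) (u' ++ v')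
| sb_cancel x b : sb_eq [:: (x, b); (x, ~~ b)] [::]
| sb_braid (i j : 'I_3) : j = i.+1 :> nat ->
    sb_eq [:: sig i; sig j; sig i] [:: sig j; sig i; sig j]
| sb_far (i j : 'I_3) : (i.+1 < j)%N ->
    sb_eq [:: sig i; sig j] [:: sig j; sig i]
| sb_epsK j : sb_eq [:: eps j; eps j] [::]
| sb_epsC j k : sb_eq [:: eps j; eps k] [:: eps k; eps j]
| sb_conj i j :
    sb_eq [:: sig i; eps j] [:: eps (tperm (lo i) (hi i) j); sig i].

Definition sb_eqb (u v : sb_word) : bool := `[< sb_eq u v >].

Lemma sb_eqb_equiv : equiv_class_of sb_eqb.
Proof.
split=> [w|u v|v u w].
- by apply/asboolP/sb_refl.
- by apply/asboolP/asboolP; apply: sb_sym.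
- by move=> /asboolP uv /asboolP vw; apply/asboolP/(sb_trans uv vw).
Qed.

Canonical sb_equiv := EquivRelPack sb_eqb_equiv.

Definition signed_braid : Type := {eq_quot sb_equiv}.
HB.instance Definition _ := Choice.on signed_braid.
HB.instance Definition _ := EqQuotient.on signed_braid.

Lemma sb_piP (u v : sb_word) :
  (\pi_signed_braid u = \pi_signed_braid v) <-> sb_eq u v.
Proof.
split; first by move/eqquotP => /= /asboolP.
by move=> uv; apply/eqquotP/asboolP.
Qed.

Lemma sb_reprP w : sb_eq (repr (\pi_signed_braid w)) w.
Proof. by apply/sb_piP; rewrite reprK. Qed.

Definition word_inv (w : sb_word) : sb_word :=
  rev [seq (x.1, ~~ x.2) | x <- w].

Lemma word_mulgV w : sb_eq (w ++ word_inv w) [::].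
Proof.
elim: w => [|[x b] w IH]; first exact: sb_refl.
have -> : word_inv ((x, b) :: w) = word_inv w ++ [:: (x, ~~ b)].
  by rewrite /word_inv /= rev_cons cats1.
apply: sb_trans (sb_cancel x b).
have -> : ((x, b) :: w) ++ word_inv w ++ [:: (x, ~~ b)]
    = [:: (x, b)] ++ (w ++ word_inv w) ++ [:: (x, ~~ b)] by rewrite /= catA.
apply: (@sb_cat _ [:: _] _ [:: _]); first exact: sb_refl.
by apply: (@sb_cat _ [::] _ [:: _]) => //; exact: sb_refl.
Qed.

Lemma word_invK : involutive word_inv.
Proof.
move=> w; rewrite /word_inv map_rev revK -map_comp -[RHS]map_id.
by apply: eq_map => -[x b] /=; rewrite negbK.
Qed.

Lemma word_mulVg w : sb_eq (word_inv w ++ w) [::].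
Proof. by rewrite -{2}(word_invK w); apply: word_mulgV. Qed.

Lemma word_inv_eq u v : sb_eq u v -> sb_eq (word_inv u) (word_inv v).
Proof.
move=> uv; rewrite -[word_inv v]cat0s -[word_inv u]cats0.
apply: (@sb_trans _ (word_inv u ++ (v ++ word_inv v))).
  by apply: sb_cat; [apply: sb_refl | apply: sb_sym; apply: word_mulgV].
rewrite catA; apply: sb_cat; last exact: sb_refl.
apply: (@sb_trans _ (word_inv u ++ u)); last exact: word_mulVg.
by apply: sb_cat; [apply: sb_refl | apply: sb_sym].
Qed.

Definition sb_one : signed_braid := \pi_signed_braid [::].
Definition sb_mul (g h : signed_braid) : signed_braid :=
  \pi_signed_braid (repr g ++ repr h).
Definition sb_inv (g : signed_braid) : signed_braid := \pi_signed_braid (word_inv (repr g)).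

Lemma sb_mul_pi u v :
  sb_mul (\pi_signed_braid u) (\pi_signed_braid v) = \pi_signed_braid (u ++ v).
Proof. by apply/sb_piP/sb_cat; apply: sb_reprP. Qed.

Lemma sb_inv_pi u : sb_inv (\pi_signed_braid u) = \pi_signed_braid (word_inv u).
Proof. by apply/sb_piP/word_inv_eq/sb_reprP. Qed.

Lemma sb_mulgA : associative sb_mul.
Proof.
elim/quotW=> u; elim/quotW=> v; elim/quotW=> w.
by rewrite (sb_mul_pi v w) (sb_mul_pi u v) !sb_mul_pi catA.
Qed.

Lemma sb_mul1g : left_id sb_one sb_mul.
Proof. by elim/quotW=> u; rewrite sb_mul_pi. Qed.

Lemma sb_mulg1 : right_id sb_one sb_mul.
Proof. by elim/quotW=> u; rewrite sb_mul_pi cats0. Qed.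

Lemma sb_mulVg : left_inverse sb_one sb_inv sb_mul.
Proof.
by elim/quotW=> u; rewrite sb_inv_pi sb_mul_pi; apply/sb_piP/word_mulVg.
Qed.

Lemma sb_mulgV : right_inverse sb_one sb_inv sb_mul.
Proof.
by elim/quotW=> u; rewrite sb_inv_pi sb_mul_pi; apply/sb_piP/word_mulgV.
Qed.

HB.instance Definition _ :=
  isGroup.Build signed_braid sb_mulgA sb_mul1g sb_mulg1 sb_mulVg sb_mulgV.

Definition sb_sigma (i : 'I_3) : signed_braid := \pi_signed_braid [:: sig i].
Definition sb_epsilon (j : 'I_4) : signed_braid := \pi_signed_braid [:: eps j].

Definition unitriangular (M : 'M[int]_4) : bool :=
  [forall k : 'I_4, forall l : 'I_4, (l <= k)%N ==> (M k l == (k == l)%:R)].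

Record utmx : Type := Utmx { utval :> 'M[int]_4; _ : unitriangular utval }.
HB.instance Definition _ := [isSub for utval].
HB.instance Definition _ := [Choice of utmx by <:].

Lemma utmxP (M : utmx) (k l : 'I_4) : (l <= k)%N -> M k l = (k == l)%:R.
Proof.
by case: M => M /= /forallP/(_ k)/forallP/(_ l)/implyP h le; apply/eqP/h.
Qed.

Lemma utmx_inj (M N : utmx) :
  (forall k l : 'I_4, (k < l)%N -> M k l = N k l) -> M = N.
Proof.
move=> h; apply/val_inj/matrixP => k l /=.
by case: (ltnP k l) => [/h //|le]; rewrite !utmxP.
Qed.

Definition fill_mx (F : 'I_4 -> 'I_4 -> int) : 'M[int]_4 :=
  \matrix_(k, l) if (k < l)%N then F k l else (k == l)%:R.

Lemma fill_mx_unitriangular F : unitriangular (fill_mx F).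
Proof.
by apply/forallP=> k; apply/forallP=> l; apply/implyP=> le; rewrite mxE ltnNge le.
Qed.

Definition fill (F : 'I_4 -> 'I_4 -> int) : utmx :=
  Utmx (fill_mx_unitriangular F).

Lemma fillE F (k l : 'I_4) : (k < l)%N -> fill F k l = F k l.
Proof. by move=> lt; rewrite mxE lt. Qed.

Definition row4 (r0 r1 r2 r3 : seq int) : 'M[int]_4 :=
  \matrix_(k, l) nth 0 (nth [::] [:: r0; r1; r2; r3] k) l.

Definition gram_mx (a b c d e f : int) : 'M[int]_4 :=
  row4 [:: 1; a; b; c]
       [:: 0; 1; d; e]
       [:: 0; 0; 1; f]
       [:: 0; 0; 0; 1].

Lemma gram_mx_unitriangular a b c d e f : unitriangular (gram_mx a b c d e f).
Proof.
apply/forallP=> -[[|[|[|[|k]]]] // hk]; apply/forallP=> -[[|[|[|[|l]]]] // hl];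
by rewrite mxE.
Qed.

Definition gram (a b c d e f : int) : utmx :=
  Utmx (gram_mx_unitriangular a b c d e f).

Definition sigma (i : 'I_3) (M : utmx) : utmx :=
  let p := lo i in let q := hi i in
  fill (fun k l =>
    if (k == p) && (l == q) then - M p q
    else if l == p then M k q - M p q * M k p
    else if l == q then M k p
    else if k == p then M q l - M p q * M p l
    else if k == q then M p l
    else M k l).

(* sigma_i^-1 replaces (e_i, e_(i+1)) by                                      *)
(* (e_(i+1), e_i - <e_i, e_(i+1)> e_(i+1)).                                   *)
Definition sigma_inv (i : 'I_3) (M : utmx) : utmx :=
  let p := lo i in let q := hi i in
  fill (fun k l =>
    if (k == p) && (l == q) then - M p q
    else if l == p then M k q
    else if l == q then M k p - M p q * M k q
    else if k == p then M q l
    else if k == q then M p l - M p q * M q l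
    else M k l).

Definition epsilon (j : 'I_4) (M : utmx) : utmx :=
  fill (fun k l => if (j == k) || (j == l) then - M k l else M k l).

Definition act_letter (x : sb_gen * bool) (M : utmx) : utmx :=
  match x with
  | (inl i, false) => sigma i M
  | (inl i, true) => sigma_inv i M
  | (inr j, _) => epsilon j M
  end.

Definition act_word (w : sb_word) (M : utmx) : utmx := foldr act_letter M w.

Definition act (g : signed_braid) (M : utmx) : utmx := act_word (repr g) M.

Definition same_orbit (M N : utmx) : Prop := exists g : signed_braid, act g M = N.

Definition coords : Type := (int * int * int * int * int * int)%type.

Definition of_coords (t : coords) : utmx :=
  let: (a, b, c, d, e, f) := t in gram a b c d e f.

Lemma of_coords_surj (M : utmx) : exists t, M = of_coords t.
Proof.
exists (M 0 1, M 0 2, M 0 3, M 1 2, M 1 3, M 2 3).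
apply: utmx_inj; (do 2!case=> -[|[|[|[|?]]]] // ?) => _; rewrite [RHS]mxE /=;
by congr (utval M _ _); apply: val_inj.
Qed.

Definition sigma_coords (i : nat) (t : coords) : coords :=
  let: (a, b, c, d, e, f) := t in
  match i with
  | 0 => (- a, d - a * b, e - a * c, b, c, f)
  | 1 => (b - d * a, a, c, - d, f - d * e, e)
  | _ => (a, c - f * b, b, e - f * d, d, - f)
  end.

Definition sigma_inv_coords (i : nat) (t : coords) : coords :=
  let: (a, b, c, d, e, f) := t in
  match i with
  | 0 => (- a, d, e, b - a * d, c - a * e, f)
  | 1 => (b, a - d * b, c, - d, f, e - d * f)
  | _ => (a, c, b - f * c, e, d - f * e, - f)
  end.

Definition epsilon_coords (j : nat) (t : coords) : coords :=
  let: (a, b, c, d, e, f) := t in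
  match j with
  | 0 => (- a, - b, - c, d, e, f)
  | 1 => (- a, b, c, - d, - e, f)
  | 2 => (a, - b, c, - d, e, - f)
  | _ => (a, b, - c, d, - e, - f)
  end.

Ltac solve_entries :=
  apply: utmx_inj; (do 2!case=> -[|[|[|[|?]]]] // ?) => _; rewrite fillE ?mxE //=;
  rewrite ?mxE /= //; ring.

Lemma sigmaE i t : sigma i (of_coords t) = of_coords (sigma_coords i t).
Proof.
move: t => [[[[[a b] c] d] e] f].
by case: i => -[|[|[|?]]] // ?; solve_entries.
Qed.

Lemma sigma_invE i t :
  sigma_inv i (of_coords t) = of_coords (sigma_inv_coords i t).
Proof.
move: t => [[[[[a b] c] d] e] f].
by case: i => -[|[|[|?]]] // ?; solve_entries.
Qed.

Lemma epsilonE j t : epsilon j (of_coords t) = of_coords (epsilon_coords j t).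
Proof.
move: t => [[[[[a b] c] d] e] f].
by case: j => -[|[|[|[|?]]]] // ?; solve_entries.
Qed.

Lemma sigmaK i : cancel (sigma i) (sigma_inv i).
Proof.
move=> M; have [[[[[[a b] c] d] e] f] ->] := of_coords_surj M.
rewrite sigmaE sigma_invE; congr of_coords.
by case: i => -[|[|[|?]]] // ?; do 5?[congr pair]; rewrite /=; ring.
Qed.

Lemma sigma_invK i : cancel (sigma_inv i) (sigma i).
Proof.
move=> M; have [[[[[[a b] c] d] e] f] ->] := of_coords_surj M.
rewrite sigma_invE sigmaE; congr of_coords.
by case: i => -[|[|[|?]]] // ?; do 5?[congr pair]; rewrite /=; ring.
Qed.

Lemma epsilonK j : involutive (epsilon j).
Proof.
move=> M; have [[[[[[a b] c] d] e] f] ->] := of_coords_surj M.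
rewrite !epsilonE; congr of_coords.
by case: j => -[|[|[|[|?]]]] // ?; rewrite /= !opprK.
Qed.

Lemma sigma_braid (i j : 'I_3) M : j = i.+1 :> nat ->
  sigma i (sigma j (sigma i M)) = sigma j (sigma i (sigma j M)).
Proof.
have [[[[[[a b] c] d] e] f] ->] := of_coords_surj M.
rewrite !sigmaE => ij; congr of_coords.
case: i j ij => -[|[|[|?]]] // ? [] [|[|[|?]]] // ? _;
  by rewrite /=; do 5?[congr pair]; ring.
Qed.

Lemma sigma_far (i j : 'I_3) M : (i.+1 < j)%N ->
  sigma i (sigma j M) = sigma j (sigma i M).
Proof.
have [[[[[[a b] c] d] e] f] ->] := of_coords_surj M.
rewrite !sigmaE => ij; congr of_coords.
case: i j ij => -[|[|[|?]]] // ? [] [|[|[|?]]] // ? _;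
  by rewrite /=; do 5?[congr pair]; ring.
Qed.

Lemma epsilonC j k M : epsilon j (epsilon k M) = epsilon k (epsilon j M).
Proof.
have [[[[[[a b] c] d] e] f] ->] := of_coords_surj M.
rewrite !epsilonE; congr of_coords.
by case: j k => -[|[|[|[|?]]]] // ? [] [|[|[|[|?]]]].
Qed.

Lemma sigma_epsilon i j M :
  sigma i (epsilon j M) = epsilon (tperm (lo i) (hi i) j) (sigma i M).
Proof.
have [[[[[[a b] c] d] e] f] ->] := of_coords_surj M.
rewrite !epsilonE !sigmaE !epsilonE permE; congr of_coords.
case: i j => -[|[|[|?]]] // ? [] [|[|[|[|?]]]] // ?;
  by rewrite /=; do 5?[congr pair]; ring.
Qed.

Lemma act_word_cat u v M : act_word (u ++ v) M = act_word u (act_word v M).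
Proof. exact: foldr_cat. Qed.

(* The words with the same class in the signed braid group act identically. *)
Lemma act_word_eq u v : sb_eq u v -> act_word u =1 act_word v.
Proof.
elim=> {u v} [//|u v _ IH M|u v w _ IHu _ IHv M|u u' v v' _ IHu _ IHv M
  |x b M|i j ij M|i j ij M|j M|j k M|i j M].
- by rewrite IH.
- by rewrite IHu IHv.
- by rewrite !act_word_cat IHu IHv.
- by case: x b => [i|j] [] /=; rewrite ?sigmaK ?sigma_invK ?epsilonK.
- exact: sigma_braid.
- exact: sigma_far.
- exact: epsilonK.
- exact: epsilonC.
- exact: sigma_epsilon.
Qed.

Lemma act_pi w M : act (\pi_signed_braid w) M = act_word w M.
Proof. by apply: act_word_eq; apply: sb_reprP. Qed.

Lemma act1 M : act 1%g M = M.
Proof. exact: act_pi. Qed.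

Lemma actM g h M : act (g * h)%g M = act g (act h M).
Proof. by rewrite act_pi act_word_cat. Qed.

Lemma act_sigma i M : act (sb_sigma i) M = sigma i M.
Proof. exact: act_pi. Qed.

Lemma act_epsilon j M : act (sb_epsilon j) M = epsilon j M.
Proof. exact: act_pi. Qed.

(* The identity matrix (all six entries zero) is alone in its orbit. It      *)
(* satisfies the quartic and quadratic equations but is not one of the normal *)
(* forms, which is why the classification is stated for nonzero entries only. *)
Lemma same_orbit_id (N : utmx) :
  same_orbit (gram 0 0 0 0 0 0) N -> N = gram 0 0 0 0 0 0.
Proof.
case=> g <-; rewrite /act; elim: (repr g) => [//|[x b] w /= ->].
rewrite -[gram _ _ _ _ _ _]/(of_coords (0, 0, 0, 0, 0, 0)).
case: x b => [i|j] []; rewrite ?sigmaE ?sigma_invE ?epsilonE.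
- by case: i => -[|[|[|?]]] // ?; rewrite /= !(mul0r, subr0, oppr0).
- by case: i => -[|[|[|?]]] // ?; rewrite /= !(mul0r, subr0, oppr0).
- by case: j => -[|[|[|[|?]]]] // ?; rewrite /= !oppr0.
- by case: j => -[|[|[|[|?]]]] // ?; rewrite /= !oppr0.
Qed.

(* Main.v *)
Require Import Defs.
From mathcomp Require Import all_boot all_order all_algebra.
From mathcomp Require Import ring zify.
Set Implicit Arguments.
Unset Strict Implicit.
Unset Printing Implicit Defensive.
Import Order.TTheory GRing.Theory Num.Theory.
Local Open Scope ring_scope.

(* The vectors [e_i] live in a lattice whose alternating form [M - M^T] has   *)
(* rank 2 (its Pfaffian vanishes) and whose monodromy [1 - M^-1 (M - M^T)] is *)
(* unipotent. Nilpotency of [M^-1 (M - M^T)] provides a vector [p] in the     *)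
(* radical of the alternating form which represents a nonzero linear form,    *)
(* the rank; writing [r_i] for the rank of [e_i], one gets the Markov-type    *)
(* relation [r1^2 + r2^2 + r3^2 + r4^2 = a r1 r2 + f r3 r4] and its cyclic    *)
(* rotations. Descent on the sum of the [|r_i|] by mutations then stops in    *)
(* one of two ways: all [r_i > 0] forces two blocks with [a = f = 2] and      *)
(* leads to the quadric, while a zero rank, rotated to [r1 = 0], leaves a     *)
(* Markov triple that descends to [(3, 3, 3)] and gives the forms indexed by  *)
(* [n]. Parity of the entries separates the quadric, and the symmetric form   *)
(* [M N^2], with [N = M^-1 (M - M^T)], which is [9 - n^2] times the square of *)
(* a primitive linear form, determines [n].                                   *)

(** Signed braids act by integral base change, which conjugates [N = M^-1 (M - M^T)]. The two
    equations make the characteristic polynomial of [N] equal to [X^4], so a nonzero [N] yields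
    ranks of the basis vectors ([exists_rank_vector]), tied to the entries by [rank_relations].

    As for Markov triples, a mutation exchanges, up to sign, the two roots of a quadratic, and
    [ranked_reducible] descends on the sum of the absolute ranks. Where the descent stops is found
    in [reducible_rank1_eq0] (ranks [(0, x, x, x)] and one free entry, which becomes [n]) and in
    [reducible_blocks] (ranks [(x, x, y, y)], ending at the quadric).

    Uniqueness comes from congruence invariants: divisibility of [M - M^T] by 2
    ([quadric_blowup_orbit]) and the factor [9 - n^2] ([blowup_orbit_inj]). *)

Definition col4 (r1 r2 r3 r4 : int) : 'cV[int]_4 :=
  \col_i nth 0 [:: r1; r2; r3; r4] i.

Lemma sum4 (R : nmodType) (F : 'I_4 -> R) :
  \sum_i F i = F 0 + F 1 + F 2 + F 3.
Proof.
rewrite !big_ord_recl big_ord0 addr0 !addrA.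
by congr (F _ + F _ + F _ + F _); apply: val_inj.
Qed.

Lemma row4_mul a00 a01 a02 a03 a10 a11 a12 a13 a20 a21 a22 a23 a30 a31 a32 a33
    b00 b01 b02 b03 b10 b11 b12 b13 b20 b21 b22 b23 b30 b31 b32 b33 :
  row4 [:: a00; a01; a02; a03] [:: a10; a11; a12; a13]
       [:: a20; a21; a22; a23] [:: a30; a31; a32; a33] *m
  row4 [:: b00; b01; b02; b03] [:: b10; b11; b12; b13]
       [:: b20; b21; b22; b23] [:: b30; b31; b32; b33] =
  row4
  [:: a00 * b00 + a01 * b10 + a02 * b20 + a03 * b30;
      a00 * b01 + a01 * b11 + a02 * b21 + a03 * b31;
      a00 * b02 + a01 * b12 + a02 * b22 + a03 * b32;
      a00 * b03 + a01 * b13 + a02 * b23 + a03 * b33]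
  [:: a10 * b00 + a11 * b10 + a12 * b20 + a13 * b30;
      a10 * b01 + a11 * b11 + a12 * b21 + a13 * b31;
      a10 * b02 + a11 * b12 + a12 * b22 + a13 * b32;
      a10 * b03 + a11 * b13 + a12 * b23 + a13 * b33]
  [:: a20 * b00 + a21 * b10 + a22 * b20 + a23 * b30;
      a20 * b01 + a21 * b11 + a22 * b21 + a23 * b31;
      a20 * b02 + a21 * b12 + a22 * b22 + a23 * b32;
      a20 * b03 + a21 * b13 + a22 * b23 + a23 * b33]
  [:: a30 * b00 + a31 * b10 + a32 * b20 + a33 * b30;
      a30 * b01 + a31 * b11 + a32 * b21 + a33 * b31;
      a30 * b02 + a31 * b12 + a32 * b22 + a33 * b32;
      a30 * b03 + a31 * b13 + a32 * b23 + a33 * b33].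
Proof.
apply/matrixP; do 2!case=> -[|[|[|[|?]]]] // ?;
by rewrite mxE sum4 !mxE.
Qed.

Lemma row4_col a00 a01 a02 a03 a10 a11 a12 a13 a20 a21 a22 a23 a30 a31 a32 a33
    r0 r1 r2 r3 :
  row4 [:: a00; a01; a02; a03] [:: a10; a11; a12; a13]
       [:: a20; a21; a22; a23] [:: a30; a31; a32; a33] *m col4 r0 r1 r2 r3 =
  col4 (a00 * r0 + a01 * r1 + a02 * r2 + a03 * r3)
       (a10 * r0 + a11 * r1 + a12 * r2 + a13 * r3)
       (a20 * r0 + a21 * r1 + a22 * r2 + a23 * r3)
       (a30 * r0 + a31 * r1 + a32 * r2 + a33 * r3).
Proof.
apply/matrixP; case=> -[|[|[|[|?]]]] // ? j; by rewrite mxE sum4 !mxE.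
Qed.

Lemma row4_tr a00 a01 a02 a03 a10 a11 a12 a13 a20 a21 a22 a23 a30 a31 a32 a33 :
  (row4 [:: a00; a01; a02; a03] [:: a10; a11; a12; a13]
        [:: a20; a21; a22; a23] [:: a30; a31; a32; a33])^T =
  row4 [:: a00; a10; a20; a30] [:: a01; a11; a21; a31]
       [:: a02; a12; a22; a32] [:: a03; a13; a23; a33].
Proof. by apply/matrixP; do 2!case=> -[|[|[|[|?]]]] // ?; rewrite !mxE. Qed.

Lemma row4_sub a00 a01 a02 a03 a10 a11 a12 a13 a20 a21 a22 a23 a30 a31 a32 a33
    b00 b01 b02 b03 b10 b11 b12 b13 b20 b21 b22 b23 b30 b31 b32 b33 :
  row4 [:: a00; a01; a02; a03] [:: a10; a11; a12; a13]
       [:: a20; a21; a22; a23] [:: a30; a31; a32; a33] -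
  row4 [:: b00; b01; b02; b03] [:: b10; b11; b12; b13]
       [:: b20; b21; b22; b23] [:: b30; b31; b32; b33] =
  row4 [:: a00 - b00; a01 - b01; a02 - b02; a03 - b03]
       [:: a10 - b10; a11 - b11; a12 - b12; a13 - b13]
       [:: a20 - b20; a21 - b21; a22 - b22; a23 - b23]
       [:: a30 - b30; a31 - b31; a32 - b32; a33 - b33].
Proof. by apply/matrixP; do 2!case=> -[|[|[|[|?]]]] // ?; rewrite !mxE. Qed.

(** * Braid moves as congruences of bilinear forms *)

(** The columns express the new basis in the old one, so Gram matrices change by [P^T M P]. *)
Definition sigma_mx (i : nat) (t : coords) : 'M[int]_4 :=
  let: (a, b, c, d, e, f) := t in
  match i with
  | 0 => row4 [:: - a; 1; 0; 0] [:: 1; 0; 0; 0] [:: 0; 0; 1; 0] [:: 0; 0; 0; 1]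
  | 1 => row4 [:: 1; 0; 0; 0] [:: 0; - d; 1; 0] [:: 0; 1; 0; 0] [:: 0; 0; 0; 1]
  | _ => row4 [:: 1; 0; 0; 0] [:: 0; 1; 0; 0] [:: 0; 0; - f; 1] [:: 0; 0; 1; 0]
  end.

Definition sigma_inv_mx (i : nat) (t : coords) : 'M[int]_4 :=
  let: (a, b, c, d, e, f) := t in
  match i with
  | 0 => row4 [:: 0; 1; 0; 0] [:: 1; - a; 0; 0] [:: 0; 0; 1; 0] [:: 0; 0; 0; 1]
  | 1 => row4 [:: 1; 0; 0; 0] [:: 0; 0; 1; 0] [:: 0; 1; - d; 0] [:: 0; 0; 0; 1]
  | _ => row4 [:: 1; 0; 0; 0] [:: 0; 1; 0; 0] [:: 0; 0; 0; 1] [:: 0; 0; 1; - f]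
  end.

Definition epsilon_mx (j : nat) : 'M[int]_4 :=
  match j with
  | 0 => row4 [:: -1; 0; 0; 0] [:: 0; 1; 0; 0] [:: 0; 0; 1; 0] [:: 0; 0; 0; 1]
  | 1 => row4 [:: 1; 0; 0; 0] [:: 0; -1; 0; 0] [:: 0; 0; 1; 0] [:: 0; 0; 0; 1]
  | 2 => row4 [:: 1; 0; 0; 0] [:: 0; 1; 0; 0] [:: 0; 0; -1; 0] [:: 0; 0; 0; 1]
  | _ => row4 [:: 1; 0; 0; 0] [:: 0; 1; 0; 0] [:: 0; 0; 1; 0] [:: 0; 0; 0; -1]
  end.

Ltac row4_ring :=
  rewrite /= ?/gram_mx ?row4_tr ?row4_sub ?(row4_mul, row4_col);
  repeat (congr row4 || congr col4 || congr cons); ring.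

Lemma sigma_congr i t :
  of_coords (sigma_coords i t) = (sigma_mx i t)^T *m of_coords t *m sigma_mx i t :> 'M_4.
Proof.
move: t => [[[[[a b] c] d] e] f].
by case: i => [|[|i]]; row4_ring.
Qed.

Lemma sigma_inv_congr i t :
  of_coords (sigma_inv_coords i t) =
  (sigma_inv_mx i t)^T *m of_coords t *m sigma_inv_mx i t :> 'M_4.
Proof.
move: t => [[[[[a b] c] d] e] f].
by case: i => [|[|i]]; row4_ring.
Qed.

Lemma epsilon_congr j t :
  of_coords (epsilon_coords j t) =
  (epsilon_mx j)^T *m of_coords t *m epsilon_mx j :> 'M_4.
Proof.
move: t => [[[[[a b] c] d] e] f].
by case: j => [|[|[|j]]]; row4_ring.
Qed.

Lemma det_utmx (M : utmx) : \det M = 1.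
Proof.
rewrite -det_tr det_trig; last first.
  apply/is_trig_mxP => i j ij; rewrite mxE (utmxP M (ltnW ij)).
  by case: eqP ij => [->|//]; rewrite ltnn.
by rewrite big1 // => i _; rewrite mxE (utmxP M (leqnn i)) eqxx.
Qed.

Lemma utmx_unit (M : utmx) : (M : 'M_4) \in unitmx.
Proof. by rewrite unitmxE det_utmx unitr1. Qed.

Lemma congr_utmx_unit (M N : utmx) (P : 'M_4) :
  N = P^T *m M *m P :> 'M_4 -> P \in unitmx.
Proof.
move=> /(congr1 determinant); rewrite !det_mulmx !det_utmx det_tr mulr1 => P1.
by rewrite unitmxE; apply/unitrP; exists (\det P).
Qed.

Lemma same_orbit_refl M : same_orbit M M.
Proof. by exists 1%g; rewrite act1. Qed.

Lemma same_orbit_trans M N L : same_orbit M N -> same_orbit N L -> same_orbit M L.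
Proof. by move=> [g <-] [h <-]; exists (h * g)%g; rewrite actM. Qed.

Lemma same_orbit_sym M N : same_orbit M N -> same_orbit N M.
Proof. by move=> [g <-]; exists g^-1%g; rewrite -actM mulVg act1. Qed.

Lemma same_orbit_sigma (i : 'I_3) t :
  same_orbit (of_coords t) (of_coords (sigma_coords i t)).
Proof. by exists (sb_sigma i); rewrite act_sigma sigmaE. Qed.

Lemma same_orbit_sigma_inv (i : 'I_3) t :
  same_orbit (of_coords t) (of_coords (sigma_inv_coords i t)).
Proof.
by apply: same_orbit_sym; exists (sb_sigma i); rewrite act_sigma -sigma_invE sigma_invK.
Qed.

Lemma same_orbit_epsilon (j : 'I_4) t :
  same_orbit (of_coords t) (of_coords (epsilon_coords j t)).
Proof. by exists (sb_epsilon j); rewrite act_epsilon epsilonE. Qed.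

Lemma act_letter_congr x (M : utmx) :
  exists P, act_letter x M = P^T *m M *m P :> 'M_4.
Proof.
have [t ->] := of_coords_surj M; case: x => [[i|j] b].
- case: b.
    exists (sigma_inv_mx i t); rewrite [act_letter _ _]sigma_invE.
    exact: sigma_inv_congr.
  by exists (sigma_mx i t); rewrite [act_letter _ _]sigmaE; apply: sigma_congr.
- exists (epsilon_mx j); rewrite [act_letter _ _]epsilonE.
  exact: epsilon_congr.
Qed.

Lemma same_orbit_congr (M N : utmx) :
  same_orbit M N -> exists P, N = P^T *m M *m P :> 'M_4.
Proof.
case=> g <-; rewrite /act; elim: (repr g) => [|x w [P IH]] /=.
  by exists 1%:M; rewrite trmx1 mul1mx mulmx1.
have [Q ->] := act_letter_congr x (act_word w M).
by exists (P *m Q); rewrite IH trmx_mul !mulmxA.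
Qed.

(* [p] is an isotropic vector of the radical of the alternating part of [M], *)
(* [r] is the linear form it represents on both sides.                        *)
Definition rank_vector (M : 'M[int]_4) (r : 'cV[int]_4) : Prop :=
  r != 0 /\ exists p w, [/\ M *m p = r, M^T *m p = r & (M - M^T) *m w = r].

(** Vectors take the coordinates [P^-1 p] in the new basis, while linear forms pull back to
    [P^T r]. *)
Lemma rank_vector_congr (M P : 'M[int]_4) r :
  P \in unitmx -> rank_vector M r -> rank_vector (P^T *m M *m P) (P^T *m r).
Proof.
move=> uP [r0 [p [w [Mp Mtp Aw]]]]; split.
  apply: contra r0 => /eqP Pr0; have uPt : P^T \in unitmx by rewrite unitmx_tr.
  by rewrite -[r](mulKmx uPt) Pr0 mulmx0.
exists (invmx P *m p), (invmx P *m w).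
have PK x : P *m (invmx P *m x) = x :> 'cV_4 by rewrite mulmxA mulmxV // mul1mx.
split.
- by rewrite -!mulmxA PK Mp.
- by rewrite !trmx_mul trmxK -!mulmxA PK Mtp.
- have -> : P^T *m M *m P - (P^T *m M *m P)^T = P^T *m (M - M^T) *m P.
    by rewrite !trmx_mul trmxK mulmxBr mulmxBl !mulmxA.
  by rewrite -!mulmxA PK Aw.
Qed.

Lemma det4 (R : comNzRingType) (F : nat -> nat -> R) :
  \det (\matrix_(i < 4, j < 4) F i j) =
  F 0 0 * (F 1 1 * (F 2 2 * F 3 3 - F 2 3 * F 3 2)
         - F 1 2 * (F 2 1 * F 3 3 - F 2 3 * F 3 1)
         + F 1 3 * (F 2 1 * F 3 2 - F 2 2 * F 3 1))
  - F 0 1 * (F 1 0 * (F 2 2 * F 3 3 - F 2 3 * F 3 2)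
         - F 1 2 * (F 2 0 * F 3 3 - F 2 3 * F 3 0)
         + F 1 3 * (F 2 0 * F 3 2 - F 2 2 * F 3 0))
  + F 0 2 * (F 1 0 * (F 2 1 * F 3 3 - F 2 3 * F 3 1)
         - F 1 1 * (F 2 0 * F 3 3 - F 2 3 * F 3 0)
         + F 1 3 * (F 2 0 * F 3 1 - F 2 1 * F 3 0))
  - F 0 3 * (F 1 0 * (F 2 1 * F 3 2 - F 2 2 * F 3 1)
         - F 1 1 * (F 2 0 * F 3 2 - F 2 2 * F 3 0)
         + F 1 2 * (F 2 0 * F 3 1 - F 2 1 * F 3 0)).
Proof.
rewrite (expand_det_row _ 0) !(big_ord_recl, big_ord0) /cofactor.
rewrite !(expand_det_row _ 0) !(big_ord_recl, big_ord0) /cofactor.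
rewrite !(expand_det_row _ 0) !(big_ord_recl, big_ord0) /cofactor.
rewrite !det_mx11 !mxE /= /bump /=.
by rewrite !(add0n, addn0, addnS) !(expr0, expr1, exprS) /=; ring.
Qed.

(** * Nilpotency and the existence of a rank vector *)

Section RankVector.

Variables a b c d e f : int.
Hypothesis h1 : a * c * d * f - a * b * d - a * c * e - b * c * f - d * e * f
          + a ^+ 2 + b ^+ 2 + c ^+ 2 + d ^+ 2 + e ^+ 2 + f ^+ 2 = 0.
Hypothesis h2 : a * f - b * e + c * d = 0.

Let M : 'M[int]_4 := gram a b c d e f.

(* [det (X M - (M - M^T)) = X^4 - Q (X - 1) X^2 + pf^2 (X - 1)^2], where [Q]  *)
(* and [pf] are the left-hand sides of [h1] and [h2].                         *)
Lemma det_pencil :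
  \det ('X *: map_mx polyC M - map_mx polyC (M - M^T)) = 'X^4.
Proof.
pose row i : seq {poly int} := nth [::]
  [:: [:: 'X; ('X - 1) * a%:P; ('X - 1) * b%:P; ('X - 1) * c%:P];
      [:: a%:P; 'X; ('X - 1) * d%:P; ('X - 1) * e%:P];
      [:: b%:P; d%:P; 'X; ('X - 1) * f%:P];
      [:: c%:P; e%:P; f%:P; 'X]] i.
have -> : 'X *: map_mx polyC M - map_mx polyC (M - M^T) =
    \matrix_(i < 4, j < 4) nth 0 (row i) j.
  rewrite /M /= /gram_mx row4_tr row4_sub.
  by apply/matrixP; do 2!case=> -[|[|[|[|?]]]] // ?;
     rewrite !mxE /= ?subrr ?subr0 ?sub0r ?polyCN; ring.
rewrite (det4 (fun i j => nth 0 (row i) j)) /row /=.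
have := congr1 polyC h1; have := congr1 polyC h2.
rewrite !(polyCD, polyCN, polyCM, polyC_exp) => E2 E1.
set Q := (LHS in LHS = 0) in E1.
set pf := (LHS in LHS = 0) in E2.
transitivity ('X^4 - Q * ('X - 1) * 'X ^+ 2 + pf ^+ 2 * ('X - 1) ^+ 2).
  by rewrite /Q /pf; ring.
by rewrite E1 E2 mul0r expr0n !mul0r subr0 addr0.
Qed.

(** Take [p = N w] in the image of the last nonzero power of [N]. Then [(M - M^T) p = M N p = 0]
    puts [p] in the radical, and [M p = M N w = (M - M^T) w]. *)
Lemma exists_rank_vector :
  (a, b, c, d, e, f) <> (0, 0, 0, 0, 0, 0) ->
  exists r, rank_vector M r.
Proof.
move=> nz; have uM : M \in unitmx by apply: utmx_unit.
pose N := invmx M *m (M - M^T).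
have MN (x : 'cV_4) : M *m (N *m x) = (M - M^T) *m x.
  by rewrite /N -mulmxA mulKVmx.
have N4 : N ^+ 4 = 0.
  have := Cayley_Hamilton N; suff -> : char_poly N = 'X^4.
    by rewrite rmorphXn /= horner_mx_X.
  (* Multiplying by [det M = 1] turns [det (X - N)] into the determinant of the pencil
     [X M - (M - M^T)]. *)
  rewrite -det_pencil -[LHS]mul1r -[1]/(1%:P) -(det_utmx (gram a b c d e f)).
  rewrite -det_map_mx -det_mulmx; congr (\det _).
  rewrite /char_poly_mx mulmxBr mul_mx_scalar -map_mxM /N mulKVmx //.
have N0 : N != 0.
  apply/eqP => /(congr1 (mulmx M)); rewrite mulmx0 /N mulKVmx // => A0.
  apply: nz; move: A0; rewrite /M /= /gram_mx row4_tr row4_sub => /matrixP A0.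
  have := (A0 0 1, A0 0 2, A0 0 3, A0 1 2, A0 1 3, A0 2 3).
  rewrite !mxE /= !subr0.
  by move=> [[[[[-> ->] ->] ->] ->] ->].
have [m /eqP Nm min] := ex_minnP (ex_intro (fun k => N ^+ k == 0) 4 (introT eqP N4)).
case: m Nm min => [|[|k]] Nm min.
- by move: Nm; rewrite expr0 => /eqP; rewrite oner_eq0.
- by move: N0; rewrite -[N]expr1 Nm eqxx.
have Nk : N ^+ k.+1 != 0 by apply/negP => /min; rewrite ltnn.
have [j rj] : exists j, col j (N ^+ k.+1) != 0.
  apply/existsP; apply: contraNT Nk; rewrite negb_exists => /forallP z.
  apply/eqP/matrixP => i j; have /negbNE/eqP/matrixP/(_ i 0) := z j.
  by rewrite !mxE.
rewrite colE in rj; pose x : 'cV[int]_4 := delta_mx j 0.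
have NX n : N *m (N ^+ n *m x) = N ^+ n.+1 *m x by rewrite mulmxA exprS.
pose w := N ^+ k *m x; pose p := N *m w.
have Ap : (M - M^T) *m p = 0 by rewrite -MN /p /w !NX Nm mul0mx mulmx0.
exists (M *m p); split.
  by apply: contra rj => /eqP Mp; rewrite -NX -/w -/p -[p](mulKmx uM) Mp mulmx0.
exists p, w; split=> //; last by rewrite -MN.
by move: Ap; rewrite mulmxBl => /eqP; rewrite subr_eq0 => /eqP.
Qed.

End RankVector.

(** * Ranks along the orbit and their relations with the entries *)

Definition ranks : Type := (int * int * int * int)%type.

Definition sigma_ranks (i : nat) (t : coords) (r : ranks) : ranks :=
  let: (a, b, c, d, e, f) := t in let: (r1, r2, r3, r4) := r in
  match i with
  | 0 => (r2 - a * r1, r1, r3, r4)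
  | 1 => (r1, r3 - d * r2, r2, r4)
  | _ => (r1, r2, r4 - f * r3, r3)
  end.

Definition sigma_inv_ranks (i : nat) (t : coords) (r : ranks) : ranks :=
  let: (a, b, c, d, e, f) := t in let: (r1, r2, r3, r4) := r in
  match i with
  | 0 => (r2, r1 - a * r2, r3, r4)
  | 1 => (r1, r3, r2 - d * r3, r4)
  | _ => (r1, r2, r4, r3 - f * r4)
  end.

Definition epsilon_ranks (j : nat) (r : ranks) : ranks :=
  let: (r1, r2, r3, r4) := r in
  match j with
  | 0 => (- r1, r2, r3, r4)
  | 1 => (r1, - r2, r3, r4)
  | 2 => (r1, r2, - r3, r4)
  | _ => (r1, r2, r3, - r4)
  end.

Definition pfaffian (t : coords) : int :=
  let: (a, b, c, d, e, f) := t in a * f - b * e + c * d.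

Definition col_ranks (r : ranks) : 'cV[int]_4 :=
  let: (r1, r2, r3, r4) := r in col4 r1 r2 r3 r4.

Definition ranked (t : coords) (r : ranks) : Prop :=
  pfaffian t = 0 /\ rank_vector (of_coords t) (col_ranks r).

Lemma ranked_sigma (i : nat) t r :
  ranked t r -> ranked (sigma_coords i t) (sigma_ranks i t r).
Proof.
move=> [pf /(rank_vector_congr (congr_utmx_unit (sigma_congr i t)))].
rewrite -sigma_congr => rv; split.
  rewrite -oppr0 -{}pf; move: t {rv} => [[[[[a b] c] d] e] f].
  by case: i => [|[|i]] /=; ring.
move: rv; congr rank_vector; move: t r {pf} => [[[[[a b] c] d] e] f] [[[r1 r2] r3] r4].
by case: i => [|[|i]]; row4_ring.
Qed.

Lemma ranked_sigma_inv (i : nat) t r :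
  ranked t r -> ranked (sigma_inv_coords i t) (sigma_inv_ranks i t r).
Proof.
move=> [pf /(rank_vector_congr (congr_utmx_unit (sigma_inv_congr i t)))].
rewrite -sigma_inv_congr => rv; split.
  rewrite -oppr0 -{}pf; move: t {rv} => [[[[[a b] c] d] e] f].
  by case: i => [|[|i]] /=; ring.
move: rv; congr rank_vector; move: t r {pf} => [[[[[a b] c] d] e] f] [[[r1 r2] r3] r4].
by case: i => [|[|i]]; row4_ring.
Qed.

Lemma ranked_epsilon (j : nat) t r :
  ranked t r -> ranked (epsilon_coords j t) (epsilon_ranks j r).
Proof.
move=> [pf /(rank_vector_congr (congr_utmx_unit (epsilon_congr j t)))].
rewrite -epsilon_congr => rv; split.
  rewrite -oppr0 -{}pf; move: t {rv} => [[[[[a b] c] d] e] f].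
  by case: j => [|[|[|j]]] /=; ring.
move: rv; congr rank_vector; move: r {pf} => [[[r1 r2] r3] r4].
by case: j => [|[|[|j]]]; row4_ring.
Qed.

Lemma col4_surj (x : 'cV[int]_4) : exists y0 y1 y2 y3, x = col4 y0 y1 y2 y3.
Proof.
exists (x 0 0), (x 1 0), (x 2 0), (x 3 0).
apply/matrixP; case=> -[|[|[|[|?]]]] // ? j; rewrite mxE (ord1 j) /=;
  by congr (x _ _); apply: val_inj.
Qed.

Lemma col4_inj x0 x1 x2 x3 y0 y1 y2 y3 :
  col4 x0 x1 x2 x3 = col4 y0 y1 y2 y3 -> [/\ x0 = y0, x1 = y1, x2 = y2 & x3 = y3].
Proof.
move=> /matrixP E; have := (E 0 0, E 1 0, E 2 0, E 3 0); rewrite !mxE /=.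
by case=> [[[]]].
Qed.

Section Relations.

Variables a b c d e f r1 r2 r3 r4 : int.
Hypothesis tr : ranked (a, b, c, d, e, f) (r1, r2, r3, r4).

(** Triangularity of [M] reads [p] off from [r]. The vanishing Pfaffian gives the three-term
    relations for any vector in the image of [M - M^T]; the linear ones that follow express that [p]
    lies in the radical, and the quadratic one that [p] is isotropic. *)
Lemma rank_relations :
  [/\ [/\ b * r2 = a * r3 + d * r1, c * r2 = a * r4 + e * r1
        & e * r3 = d * r4 + f * r2],
      d * (r3 - f * r4) + e * r4 = a * r1,
      d * (r2 - a * r1) + b * r1 = f * r4,
      a * (r2 - d * (r3 - f * r4) - e * r4) + b * (r3 - f * r4) + c * r4 = 0
    & r1 ^+ 2 + r2 ^+ 2 + r3 ^+ 2 + r4 ^+ 2 = a * r1 * r2 + f * r3 * r4].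
Proof.
have [pf [_ [p [w []]]]] := tr.
have [p0 [p1 [p2 [p3 ->]]]] := col4_surj p.
have [w0 [w1 [w2 [w3 ->]]]] := col4_surj w.
rewrite /= /gram_mx row4_tr row4_sub !row4_col.
move=> /col4_inj[m0 m1 m2 m3] /col4_inj[n0 n1 n2 n3] /col4_inj[a0 a1 a2 a3].
have P0 : p0 = r1 by lia.
have P1 : p1 = r2 - a * r1 by rewrite -P0; lia.
have P3 : p3 = r4 by lia.
have P2 : p2 = r3 - f * r4 by rewrite -P3; lia.
rewrite /= in pf.
have pfw (x : int) : (a * f - b * e + c * d) * x = 0 by rewrite pf mul0r.
split.
- split.
  + by have := pfw w3; rewrite -a0 -a1 -a2; lia.
  + by have := pfw w2; rewrite -a0 -a1 -a3; lia.
  + by have := pfw w0; rewrite -a1 -a2 -a3; lia.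
- by rewrite -P2 -P3 -P0; lia.
- by rewrite -P1 -P0 -P3; lia.
- have -> : r2 - d * (r3 - f * r4) - e * r4 = p1 by rewrite -P2 -P3; lia.
  by rewrite -P2 -P3; lia.
- have z0 : a * p1 + b * p2 + c * p3 = 0 by lia.
  have z1 : d * p2 + e * p3 - a * p0 = 0 by lia.
  have z2 : f * p3 - b * p0 - d * p1 = 0 by lia.
  have z3 : c * p0 + e * p1 + f * p2 = 0 by lia.
  (* With [A = M - M^T], the pairing of [p] and [r] is [p^T A w = - (A p)^T w = 0]. *)
  have E : r1 * p0 + r2 * p1 + r3 * p2 + r4 * p3 = 0.
    transitivity (w3 * (c * p0 + e * p1 + f * p2)
      - (w0 * (a * p1 + b * p2 + c * p3) + w1 * (d * p2 + e * p3 - a * p0)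
         + w2 * (f * p3 - b * p0 - d * p1))).
      by rewrite -a0 -a1 -a2 -a3; ring.
    by rewrite z0 z1 z2 z3 !mulr0 !(addr0, oppr0).
  by move: E; rewrite P0 P1 P2 P3; lia.
Qed.

Lemma ranks_neq0 : ~ [/\ r1 = 0, r2 = 0, r3 = 0 & r4 = 0].
Proof.
case: tr => _ [/eqP r0 _] [E1 E2 E3 E4]; apply: r0.
by apply/matrixP; case=> -[|[|[|[|?]]]] // ? j; rewrite !mxE.
Qed.

(* [e_1] is moved to the end of the collection, which keeps its rank. *)
Lemma ranked_rotate : exists x y z,
  same_orbit (of_coords (a, b, c, d, e, f)) (of_coords (d, e, x, f, y, z)) /\
  ranked (d, e, x, f, y, z) (r2, r3, r4, r1).
Proof.
have so := same_orbit_trans (same_orbit_trans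
  (same_orbit_sigma_inv 0 (a, b, c, d, e, f)) (same_orbit_sigma_inv 1 _))
  (same_orbit_sigma_inv 2 _).
have := ranked_sigma_inv 2 (ranked_sigma_inv 1 (ranked_sigma_inv 0 tr)).
(* This relation cancels the corrections that [r1] picks up while passing the other three
   vectors. *)
have [_ _ _ L0 _] := rank_relations.
rewrite /= in so *.
set R := (r1 - _ - _ - _); have -> : R = r1 by rewrite /R; lia.
by move=> ?; do 3 eexists; split; [exact: so | done].
Qed.

End Relations.

(** * Descent on the rank sum; the case of a zero rank *)

Definition normal_form (N : utmx) : Prop :=
  N = gram 2 2 4 0 2 2 \/ exists n : nat, N = gram n%:Z (2 * n%:Z) n%:Z 3 3 3.

Definition reducible (t : coords) : Prop :=
  exists N, normal_form N /\ same_orbit (of_coords t) N.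

Lemma reducible_orbit t t' :
  same_orbit (of_coords t) (of_coords t') -> reducible t' -> reducible t.
Proof. by move=> tt' [N [nN t'N]]; exists N; split=> //; apply: same_orbit_trans t'N. Qed.

Definition rank_sum (r : ranks) : int :=
  let: (r1, r2, r3, r4) := r in `|r1| + `|r2| + `|r3| + `|r4|.

Definition reducible_below (s : int) : Prop :=
  forall t r, ranked t r -> rank_sum r < s -> reducible t.

Lemma below_sigma (i : 'I_3) t r s :
  reducible_below s -> ranked t r -> rank_sum (sigma_ranks i t r) < s -> reducible t.
Proof.
move=> lo tr lt; apply: (reducible_orbit (same_orbit_sigma i t)).
exact: lo (ranked_sigma i tr) lt.
Qed.

Lemma below_sigma_inv (i : 'I_3) t r s :
  reducible_below s -> ranked t r -> rank_sum (sigma_inv_ranks i t r) < s ->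
  reducible t.
Proof.
move=> lo tr lt; apply: (reducible_orbit (same_orbit_sigma_inv i t)).
exact: lo (ranked_sigma_inv i tr) lt.
Qed.

(* [k] is the coefficient such that [z] and [k y - z] are the roots of the    *)
(* Markov equation in its largest variable.                                   *)
Lemma markov_minimal_sorted (x y z k : int) :
  0 < x -> x <= y -> y <= z -> x ^+ 2 + y ^+ 2 + z ^+ 2 = k * y * z ->
  z ^+ 2 <= x ^+ 2 + y ^+ 2 -> [/\ k = 3, x = y & y = z].
Proof.
move=> x0 xy yz E le.
have zk : 2 * z <= k * y.
  have : 2 * z * z <= k * y * z by rewrite -E; lia.
  by rewrite -subr_ge0 -mulrBl pmulr_lge0 ?subr_ge0 //; lia.
have ky : k * y ^+ 2 <= x ^+ 2 + 2 * y ^+ 2.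
  (* This is the value at [y] of the quadratic with roots [z] and [k y - z], and [y] lies to the
     left of both. *)
  have : 0 <= (z - y) * (k * y - z - y) by apply: mulr_ge0; lia.
  by move: E; lia.
have k3 : k <= 3.
  have x2y2 : x ^+ 2 <= y ^+ 2 by nia.
  have : 0 <= (3 - k) * y ^+ 2 by lia.
  by rewrite pmulr_lge0; [lia|nia].
have k1 : 0 < k.
  have : 0 < k * (y * z) by rewrite mulrA -E; nia.
  by rewrite pmulr_lgt0 //; nia.
have [k2|[k2|k2]] : k = 1 \/ k = 2 \/ k = 3 by lia.
- by move: E; rewrite k2 mul1r; nia.
- have : x ^+ 2 + (y - z) ^+ 2 = 0 by move: E; rewrite k2; lia.
  by nia.
- have xy' : x = y by move: ky; rewrite k2; nia.
  split=> //; have : (z - y) * (z - 2 * y) = 0 by move: E; rewrite k2 xy'; lia.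
  move/eqP; rewrite mulf_eq0 => /orP[/eqP|/eqP]; first by lia.
  move=> zy; have {zy}zy : z = 2 * y by lia.
  by move: le; rewrite xy' zy; nia.
Qed.

(** Whatever the order of the variables, one of the three equations carries the product of the two
    largest, as [markov_minimal_sorted] requires. *)
Lemma markov_minimal (x y z f g d : int) :
  0 < x -> 0 < y -> 0 < z ->
  x ^+ 2 + y ^+ 2 + z ^+ 2 = f * y * z ->
  x ^+ 2 + y ^+ 2 + z ^+ 2 = d * x * y ->
  x ^+ 2 + y ^+ 2 + z ^+ 2 = g * x * z ->
  x ^+ 2 <= y ^+ 2 + z ^+ 2 -> y ^+ 2 <= x ^+ 2 + z ^+ 2 ->
  z ^+ 2 <= x ^+ 2 + y ^+ 2 ->
  [/\ x = y, y = z, f = 3, g = 3 & d = 3].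
Proof.
move=> x0 y0 z0 Ef Ed Eg xle yle zle.
suff [xy yz] : x = y /\ y = z.
  have c3 k : 3 * x ^+ 2 = k * x ^+ 2 -> k = 3.
    move=> E; have : (k - 3) * x ^+ 2 = 0 by rewrite mulrBl -E subrr.
    by move/eqP; rewrite mulf_eq0 expf_eq0 /= => /orP[] /eqP; lia.
  by split=> //; apply: c3; move: Ef Ed Eg; rewrite -?yz -?xy; lia.
have [xy|yx] := leP x y; have [yz|zy] := leP y z; have [xz|zx] := leP x z.
- by case: (markov_minimal_sorted x0 xy yz Ef zle).
- by lia.
- have E : x ^+ 2 + z ^+ 2 + y ^+ 2 = f * z * y by lia.
  by case: (markov_minimal_sorted x0 xz (ltW zy) E yle); lia.
- have E : z ^+ 2 + x ^+ 2 + y ^+ 2 = d * x * y by lia.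
  have yle' : y ^+ 2 <= z ^+ 2 + x ^+ 2 by lia.
  by case: (markov_minimal_sorted z0 (ltW zx) xy E yle'); lia.
- have E : y ^+ 2 + x ^+ 2 + z ^+ 2 = g * x * z by lia.
  have zle' : z ^+ 2 <= y ^+ 2 + x ^+ 2 by lia.
  by case: (markov_minimal_sorted y0 (ltW yx) xz E zle'); lia.
- have E : y ^+ 2 + z ^+ 2 + x ^+ 2 = g * z * x by lia.
  by case: (markov_minimal_sorted y0 yz (ltW zx) E xle); lia.
- by lia.
- have E : z ^+ 2 + y ^+ 2 + x ^+ 2 = d * y * x by lia.
  have xle' : x ^+ 2 <= z ^+ 2 + y ^+ 2 by lia.
  by case: (markov_minimal_sorted z0 (ltW zy) (ltW yx) E xle'); lia.
Qed.

(** With [r1 = 0] the relations make [(r2, r3, r4)] satisfy one Markov equation written with three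
    coefficients, and mutations of the last three vectors are its Vieta moves. At a minimal triple
    only the entries [(a, a, a, 3, 6, 3)] survive. *)
Lemma reducible_rank1_eq0 a b c d e f r2 r3 r4 :
  ranked (a, b, c, d, e, f) (0, r2, r3, r4) -> 0 <= r2 -> 0 <= r3 -> 0 <= r4 ->
  reducible_below (r2 + r3 + r4) -> reducible (a, b, c, d, e, f).
Proof.
move=> tr r2_ge0 r3_ge0 r4_ge0 lo.
have [[Tb Tc _] L1 L2 _ Q] := rank_relations tr; have nz := ranks_neq0 tr.
have L2' : d * r2 = f * r4 by lia.
have Q' : r2 ^+ 2 + r3 ^+ 2 + r4 ^+ 2 = f * r3 * r4 by lia.
have r3_gt0 : 0 < r3.
  rewrite lt_neqAle r3_ge0 andbT eq_sym; apply/eqP => r30.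
  by apply: nz; move: Q'; rewrite r30 => Q'; split=> //; nia.
have r4_gt0 : 0 < r4.
  rewrite lt_neqAle r4_ge0 andbT eq_sym; apply/eqP => r40.
  by apply: nz; move: Q'; rewrite r40 => Q'; split=> //; nia.
have f_gt0 : 0 < f.
  have : 0 < f * (r3 * r4) by rewrite mulrA -Q'; nia.
  by rewrite pmulr_lgt0 // mulr_gt0.
have r2_gt0 : 0 < r2.
  rewrite lt_neqAle r2_ge0 andbT eq_sym; apply/eqP => r20.
  by move: L2'; rewrite r20; nia.
have d_gt0 : 0 < d by have : 0 < d * r2 by [rewrite L2' mulr_gt0|]; rewrite pmulr_lgt0.
(* The mutation replaces [r4] by [r4 - f r3], smaller in absolute value as soon as
   [0 < f r3 < 2 r4]. *)
have [lt|zle] := ltP (f * r3) (2 * r4).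
  have ? : 0 < f * r3 by rewrite mulr_gt0.
  by apply: (below_sigma (i := 2) lo tr); rewrite /=; lia.
have [lt|yle] := ltP (f * r4) (2 * r3).
  have ? : 0 < f * r4 by rewrite mulr_gt0.
  by apply: (below_sigma_inv (i := 2) lo tr); rewrite /=; lia.
have [lt|xle] := ltP (d * r3) (2 * r2).
  have ? : 0 < d * r3 by rewrite mulr_gt0.
  by apply: (below_sigma_inv (i := 1) lo tr); rewrite /=; lia.
have Qd : r2 ^+ 2 + r3 ^+ 2 + r4 ^+ 2 = d * r2 * r3 by rewrite L2' Q'; lia.
(* Up to sign, [d f - e] pairs the second vector with the third one after mutating the last pair. *)
have Qe : r2 ^+ 2 + r3 ^+ 2 + r4 ^+ 2 = (d * f - e) * r2 * r4.
  have -> : (d * f - e) * r2 * r4 = (d * f * r4 - e * r4) * r2 by ring.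
  have -> : d * f * r4 - e * r4 = d * r3 by lia.
  by rewrite Qd; ring.
have [|||e23 e34 f3 e6 d3] := markov_minimal r2_gt0 r3_gt0 r4_gt0 Q' Qd Qe.
- by have : 2 * r2 * r2 <= d * r3 * r2 by [rewrite ler_pM2r|]; move: Qd; lia.
- by have : 2 * r3 * r3 <= f * r4 * r3 by [rewrite ler_pM2r|]; move: Q'; lia.
- by have : 2 * r4 * r4 <= f * r3 * r4 by [rewrite ler_pM2r|]; move: Q'; lia.
have {}e6 : e = 6 by move: e6; rewrite d3 f3; lia.
have ba : b = a by apply: (mulIf (lt0r_neq0 r2_gt0)); rewrite Tb d3 -e23; ring.
have ca : c = a by apply: (mulIf (lt0r_neq0 r2_gt0)); rewrite Tc -e34 -e23; ring.
(* Mutating the middle pair gives [(a, - 2 a, a, -3, 3, -3)]; flipping the third vector corrects the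
   signs. *)
have so : same_orbit (of_coords (a, b, c, d, e, f))
    (of_coords (a, 2 * a, a, 3, 3, 3)).
  apply: (same_orbit_trans (same_orbit_sigma_inv 1 _)).
  rewrite ba ca d3 e6 f3 /=.
  apply: (same_orbit_trans (same_orbit_epsilon 2 (_, _, _, _, _, _))).
  rewrite [of_coords _]/(gram _ _ _ _ _ _).
  have -> : - (a - 3 * a) = 2 * a by ring.
  exact: same_orbit_refl.
have [a_ge0|a_lt0] := leP 0 a.
  exists (gram a (2 * a) a 3 3 3); split; last exact: so.
  by right; exists `|a|%N; rewrite gez0_abs.
exists (gram (- a) (2 * - a) (- a) 3 3 3); split.
  by right; exists `|a|%N; rewrite ltz0_abs.
apply: (same_orbit_trans so).
apply: (same_orbit_trans (same_orbit_epsilon 0 (_, _, _, _, _, _))).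
rewrite [of_coords _]/(gram _ _ _ _ _ _) mulrN.
exact: same_orbit_refl.
Qed.

(* The entries forced by ranks [(x, x, y, y)] and [a = f = 2], where           *)
(* [k = 2 x / y] and [l = 2 y / x]; [d] is free.                              *)
Definition block_coords (k l d : int) : coords :=
  (2, d + l, d + k + l, d, d + k, 2).

(** * Four positive ranks: two blocks and the quadric *)

(** Mutating the last pair only changes a sign among the ranks, as [y - 2 y = - y]; once the sign is
    restored, what remains is a translation of [d]. *)
Lemma block_shift k l d x y : ranked (block_coords k l d) (x, x, y, y) ->
  same_orbit (of_coords (block_coords k l d)) (of_coords (block_coords k l (d - k)))
  /\ ranked (block_coords k l (d - k)) (x, x, y, y).
Proof.
move=> tr; have so := same_orbit_trans (same_orbit_sigma 2 (block_coords k l d))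
  (same_orbit_epsilon 2 _).
have := ranked_epsilon 2 (ranked_sigma 2 tr).
have -> : epsilon_ranks 2 (sigma_ranks 2 (block_coords k l d) (x, x, y, y))
  = (x, x, y, y) by rewrite /=; congr (_, _, _, _); ring.
have E : epsilon_coords 2 (sigma_coords 2 (block_coords k l d))
  = block_coords k l (d - k) by rewrite /=; congr (_, _, _, _, _, _); ring.
by rewrite -E.
Qed.

Lemma block_shift_inv k l d x y : ranked (block_coords k l d) (x, x, y, y) ->
  same_orbit (of_coords (block_coords k l d)) (of_coords (block_coords k l (d + k)))
  /\ ranked (block_coords k l (d + k)) (x, x, y, y).
Proof.
move=> tr; have so := same_orbit_trans
  (same_orbit_sigma_inv 2 (block_coords k l d)) (same_orbit_epsilon 3 _).
have := ranked_epsilon 3 (ranked_sigma_inv 2 tr).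
have -> : epsilon_ranks 3 (sigma_inv_ranks 2 (block_coords k l d) (x, x, y, y))
  = (x, x, y, y) by rewrite /=; congr (_, _, _, _); ring.
have E : epsilon_coords 3 (sigma_inv_coords 2 (block_coords k l d))
  = block_coords k l (d + k) by rewrite /=; congr (_, _, _, _, _, _); ring.
by rewrite -E.
Qed.

Lemma block_shifts k l d x y (j : int) :
  ranked (block_coords k l d) (x, x, y, y) ->
  same_orbit (of_coords (block_coords k l d))
             (of_coords (block_coords k l (d + j * k)))
  /\ ranked (block_coords k l (d + j * k)) (x, x, y, y).
Proof.
move=> tr; elim/int_rect: j => [|n [so tr']|n [so tr']].
- by rewrite mul0r addr0; split=> //; exact: same_orbit_refl.
- have [so' tr''] := block_shift_inv tr'.
  have -> : d + n.+1%:Z * k = d + n%:Z * k + k by lia.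
  by split=> //; apply: same_orbit_trans so'.
- have [so' tr''] := block_shift tr'.
  have -> : d + - n.+1%:Z * k = d + - n%:Z * k - k by lia.
  by split=> //; apply: same_orbit_trans so'.
Qed.

(** Since [k l = 4], there are three cases. The quadric is [k = l = 2] with [d = 0]; in all others a
    mutation across the blocks lowers the rank sum, if need be after a preliminary move. *)
Lemma reducible_blocks_small k l d x y :
  ranked (block_coords k l d) (x, x, y, y) -> 0 < x -> 0 < y ->
  k * y = 2 * x -> l * x = 2 * y -> 0 <= d < k ->
  reducible_below (x + x + y + y) -> reducible (block_coords k l d).
Proof.
move=> tr x0 y0 kE lE dk lo.
have k0 : 0 < k by lia.
have l0 : 0 < l by rewrite -(pmulr_lgt0 _ x0) lE mulr_gt0.
have kl : k * l = 4.
  apply: (mulIf (lt0r_neq0 y0)).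
  have -> : k * l * y = (k * y) * l by ring.
  have -> : k * y * l = (l * x) * 2 by rewrite kE; ring.
  by rewrite lE; ring.
have [[k1 l4]|[[k2 l2]|[k4 l1]]] :
  (k = 1 /\ l = 4) \/ (k = 2 /\ l = 2) \/ (k = 4 /\ l = 1).
- have k5 : k < 5 by nia.
  have K : k = 1 \/ k = 2 \/ k = 3 \/ k = 4 by lia.
  by case: K => [E|[E|[E|E]]]; move: kl; rewrite E; lia.
(* Here [y = 2 x]; after a shift to [d = 1], the rank [y - x] replaces [y]. *)
- have d0 : d = 0 by lia.
  subst k l d.
  have so : same_orbit (of_coords (block_coords 1 4 0)) (of_coords (block_coords 1 4 1)).
    by have [] := block_shift_inv tr.
  have [_ tr1] := block_shift_inv tr.
  apply: (reducible_orbit so); apply: (below_sigma (i := 1) lo tr1).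
  by rewrite /=; lia.
- have [d0|d1] : d = 0 \/ d = 1 by lia.
    subst k l d; exists (gram 2 2 4 0 2 2); split; first by left.
    exact: same_orbit_refl.
  by subst k l d; apply: (below_sigma (i := 1) lo tr); rewrite /=; lia.
- have [d0|[d1|[d2|d3]]] : d = 0 \/ d = 1 \/ d = 2 \/ d = 3 by lia.
  (* Here [x = 2 y]. As [d = 0], the middle vectors just swap; the first entry is then 1, so [x - y]
     replaces [x]. *)
  + subst k l d; apply: (reducible_orbit (same_orbit_sigma 1 _)).
    by apply: (below_sigma_inv (i := 0) lo (ranked_sigma 1 tr)); rewrite /=; lia.
  + by subst k l d; apply: (below_sigma_inv (i := 1) lo tr); rewrite /=; lia.
  + by subst k l d; apply: (below_sigma_inv (i := 1) lo tr); rewrite /=; lia.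
  + by subst k l d; apply: (below_sigma_inv (i := 1) lo tr); rewrite /=; lia.
Qed.

Lemma reducible_blocks a b c d e f r1 r2 r3 r4 :
  ranked (a, b, c, d, e, f) (r1, r2, r3, r4) ->
  0 < r1 -> 0 < r2 -> 0 < r3 -> 0 < r4 -> 0 < a -> 0 < f ->
  reducible_below (r1 + r2 + r3 + r4) -> reducible (a, b, c, d, e, f).
Proof.
move=> tr r1_gt0 r2_gt0 r3_gt0 r4_gt0 a_gt0 f_gt0 lo.
have [[Tb Tc _] L1 L2 _ Q] := rank_relations tr.
have [lt|le12] := ltP (a * r1) (2 * r2).
  have ? : 0 < a * r1 by rewrite mulr_gt0.
  by apply: (below_sigma (i := 0) lo tr); rewrite /=; lia.
have [lt|le21] := ltP (a * r2) (2 * r1).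
  have ? : 0 < a * r2 by rewrite mulr_gt0.
  by apply: (below_sigma_inv (i := 0) lo tr); rewrite /=; lia.
have [lt|le34] := ltP (f * r3) (2 * r4).
  have ? : 0 < f * r3 by rewrite mulr_gt0.
  by apply: (below_sigma (i := 2) lo tr); rewrite /=; lia.
have [lt|le43] := ltP (f * r4) (2 * r3).
  have ? : 0 < f * r4 by rewrite mulr_gt0.
  by apply: (below_sigma_inv (i := 2) lo tr); rewrite /=; lia.
(* The next four bounds add up to twice the Markov-type relation, so each is an equality. *)
have A1 : 2 * r1 * r1 <= a * r2 * r1 by rewrite ler_pM2r.
have A2 : 2 * r2 * r2 <= a * r1 * r2 by rewrite ler_pM2r.
have F3 : 2 * r3 * r3 <= f * r4 * r3 by rewrite ler_pM2r.
have F4 : 2 * r4 * r4 <= f * r3 * r4 by rewrite ler_pM2r.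
have sq12 : r1 ^+ 2 = r2 ^+ 2 by lia.
have sq34 : r3 ^+ 2 = r4 ^+ 2 by lia.
have e12 : r1 = r2 by nia.
have e34 : r3 = r4 by nia.
subst r2 r4; set x := r1 in r1_gt0 *; set y := r3 in r3_gt0 *.
have a_ge2 : 2 <= a by rewrite -(ler_pM2r r1_gt0).
have f_ge2 : 2 <= f by rewrite -(ler_pM2r r3_gt0).
have a2 : a = 2.
  have : (a - 2) * r1 ^+ 2 = 0 by lia.
  by move/eqP; rewrite mulf_eq0 expf_eq0 /= => /orP[] /eqP; lia.
have f2 : f = 2.
  have : (f - 2) * r3 ^+ 2 = 0 by lia.
  by move/eqP; rewrite mulf_eq0 expf_eq0 /= => /orP[] /eqP; lia.
subst a f; pose k := e - d; pose l := b - d.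
have Eb : b = d + l by rewrite /l; ring.
have Ee : e = d + k by rewrite /k; ring.
have kE : k * y = 2 * x by rewrite /k; lia.
have lE : l * x = 2 * y by rewrite /l; lia.
have Ec : c = d + k + l.
  apply: (mulIf (lt0r_neq0 r1_gt0)); rewrite Tc.
  have -> : (d + k + l) * r1 = (d + k) * r1 + l * x by rewrite /x; ring.
  by rewrite lE -Ee /y; ring.
have Et : (2, b, c, d, e, 2) = block_coords k l d by rewrite Eb Ec Ee.
rewrite {}Et in tr *.
(* Division with remainder brings [d] into [[0, k)]. *)
have [so tr'] := block_shifts (- (d %/ k)%Z) tr.
apply: (reducible_orbit so); apply: (reducible_blocks_small tr') => //.
have k_gt0 : 0 < k by rewrite -(pmulr_lgt0 _ r3_gt0) kE mulr_gt0.
have -> : d + - (d %/ k)%Z * k = (d %% k)%Z by rewrite {1}(divz_eq d k); ring.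
by rewrite modz_ge0 ?ltz_pmod ?lt0r_neq0.
Qed.

(** If [a] and [d] were both nonpositive, the Markov-type relation would force [f > 0], then
    [b r1 = f r4 - d (r2 - a r1)] would force [b > 0], against [b r2 = a r3 + d r1]. *)
Lemma edges12_23_pos a b c d e f r1 r2 r3 r4 :
  ranked (a, b, c, d, e, f) (r1, r2, r3, r4) ->
  0 < r1 -> 0 < r2 -> 0 < r3 -> 0 < r4 -> a <= 0 -> 0 < d.
Proof.
move=> tr r1_gt0 r2_gt0 r3_gt0 r4_gt0 a_le0; rewrite ltNge; apply/negP => d_le0.
have [[Tb _ _] _ L2 _ Q] := rank_relations tr.
have ar_le0 x : 0 < x -> a * x <= 0 by move=> ?; rewrite pmulr_lle0.
have dr_le0 x : 0 < x -> d * x <= 0 by move=> ?; rewrite pmulr_lle0.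
have f_gt0 : 0 < f.
  rewrite -(pmulr_lgt0 _ (mulr_gt0 r3_gt0 r4_gt0)).
  have := ar_le0 _ (mulr_gt0 r1_gt0 r2_gt0); have : 0 < r1 ^+ 2 by rewrite exprn_gt0.
  have := sqr_ge0 r2; have := sqr_ge0 r3; have := sqr_ge0 r4.
  by lia.
have b_gt0 : 0 < b.
  rewrite -(pmulr_lgt0 _ r1_gt0).
  have : 0 < f * r4 by rewrite mulr_gt0.
  have : 0 < r2 - a * r1 by have := ar_le0 _ r1_gt0; lia.
  by move/dr_le0; lia.
have : 0 < b * r2 by rewrite mulr_gt0.
have := ar_le0 _ r3_gt0; have := dr_le0 _ r1_gt0; lia.
Qed.

(** In the cycle of the four vectors, two adjacent edges are never both nonpositive. Hence some
    opposite pair of edges is positive, and a rotation moves it to [(a, f)]. *)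
Lemma reducible_pos a b c d e f r1 r2 r3 r4 :
  ranked (a, b, c, d, e, f) (r1, r2, r3, r4) ->
  0 < r1 -> 0 < r2 -> 0 < r3 -> 0 < r4 ->
  reducible_below (r1 + r2 + r3 + r4) -> reducible (a, b, c, d, e, f).
Proof.
move=> tr r1_gt0 r2_gt0 r3_gt0 r4_gt0 lo.
have [x [y [z [so1 tr1]]]] := ranked_rotate tr.
have [x' [y' [a' [so2 tr2]]]] := ranked_rotate tr1.
have [x'' [y'' [d' [_ tr3]]]] := ranked_rotate tr2.
have [_ _ _ _ Q] := rank_relations tr.
have [_ _ _ _ Q1] := rank_relations tr1.
have [_ _ _ _ Q2] := rank_relations tr2.
have [_ _ _ _ Q3] := rank_relations tr3.
(* The Markov-type relations before and after a half turn differ only in this coefficient. *)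
have ea : a' = a.
  by apply: (mulIf (lt0r_neq0 (mulr_gt0 r1_gt0 r2_gt0))); lia.
have ed : d' = d.
  by apply: (mulIf (lt0r_neq0 (mulr_gt0 r2_gt0 r3_gt0))); lia.
subst a' d'.
have ad := edges12_23_pos tr r1_gt0 r2_gt0 r3_gt0 r4_gt0.
have df := edges12_23_pos tr1 r2_gt0 r3_gt0 r4_gt0 r1_gt0.
have fz := edges12_23_pos tr2 r3_gt0 r4_gt0 r1_gt0 r2_gt0.
have za := edges12_23_pos tr3 r4_gt0 r1_gt0 r2_gt0 r3_gt0.
have [[a_gt0 f_gt0]|[d_gt0 z_gt0]] : (0 < a /\ 0 < f) \/ (0 < d /\ 0 < z).
- by lia.
- exact: reducible_blocks tr _ _ _ _ _ _ lo.
- apply: (reducible_orbit so1); apply: (reducible_blocks tr1) => //.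
  by move=> t r trr lt; apply: (lo t r) => //; lia.
Qed.

(** * Assembling the descent *)

Lemma reducible_nonneg a b c d e f r1 r2 r3 r4 :
  ranked (a, b, c, d, e, f) (r1, r2, r3, r4) ->
  0 <= r1 -> 0 <= r2 -> 0 <= r3 -> 0 <= r4 ->
  reducible_below (r1 + r2 + r3 + r4) -> reducible (a, b, c, d, e, f).
Proof.
move=> tr p1 p2 p3 p4 lo.
have lo' s : s = r1 + r2 + r3 + r4 -> reducible_below s by move=> ->.
have [r1_0|r1_0] := eqVneq r1 0.
  subst r1; apply: (reducible_rank1_eq0 tr) => //; apply: lo'; ring.
have [x [y [z [so1 tr1]]]] := ranked_rotate tr.
have [r2_0|r2_0] := eqVneq r2 0.
  subst r2; apply: (reducible_orbit so1).
  by apply: (reducible_rank1_eq0 tr1) => //; apply: lo'; ring.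
have [x' [y' [z' [so2 tr2]]]] := ranked_rotate tr1.
have [r3_0|r3_0] := eqVneq r3 0.
  subst r3; apply: (reducible_orbit (same_orbit_trans so1 so2)).
  by apply: (reducible_rank1_eq0 tr2) => //; apply: lo'; ring.
have [x'' [y'' [z'' [so3 tr3]]]] := ranked_rotate tr2.
have [r4_0|r4_0] := eqVneq r4 0.
  subst r4; apply: (reducible_orbit (same_orbit_trans (same_orbit_trans so1 so2) so3)).
  by apply: (reducible_rank1_eq0 tr3) => //; apply: lo'; ring.
by apply: (reducible_pos tr) => //; rewrite lt0r ?r1_0 ?r2_0 ?r3_0 ?r4_0.
Qed.

Lemma ranked_abs (j : 'I_4) t r : ranked t r -> exists t',
  same_orbit (of_coords t) (of_coords t') /\
  ranked t' (let: (r1, r2, r3, r4) := r in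
    match j : nat with
    | 0 => (`|r1|, r2, r3, r4)
    | 1 => (r1, `|r2|, r3, r4)
    | 2 => (r1, r2, `|r3|, r4)
    | _ => (r1, r2, r3, `|r4|)
    end).
Proof.
move: r => [[[r1 r2] r3] r4] tr; have tr' := ranked_epsilon j tr.
have so := same_orbit_epsilon j t; have so0 := same_orbit_refl (of_coords t).
case: j tr' so => -[|[|[|[|?]]]] // ?; set j := Ordinal _; rewrite /= => tr' so.
- by have [r0|r0] := ger0P r1; [exists t | exists (epsilon_coords 0 t)].
- by have [r0|r0] := ger0P r2; [exists t | exists (epsilon_coords 1 t)].
- by have [r0|r0] := ger0P r3; [exists t | exists (epsilon_coords 2 t)].
- by have [r0|r0] := ger0P r4; [exists t | exists (epsilon_coords 3 t)].
Qed.

Lemma ranked_reducible t r : ranked t r -> reducible t.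
Proof.
have [n] : exists n : nat, rank_sum r < n%:Z.
  by exists (`|rank_sum r|.+1)%N; lia.
elim: n t r => [|n IH] t [[[r1 r2] r3] r4] lt tr; first by rewrite /= in lt; lia.
have [t1 [so1 {}tr]] := ranked_abs 0 tr.
have [t2 [so2 {}tr]] := ranked_abs 1 tr.
have [t3 [so3 {}tr]] := ranked_abs 2 tr.
have [t4 [so4 {}tr]] := ranked_abs 3 tr.
apply: (reducible_orbit so1); apply: (reducible_orbit so2).
apply: (reducible_orbit so3); apply: (reducible_orbit so4).
move: t4 tr {so4} => [[[[[a b] c] d] e] f] tr.
apply: (reducible_nonneg tr) => // t' r' tr' lt'.
by apply: IH tr'; rewrite /= in lt; lia.
Qed.

(** * Invariants separating the normal forms *)

Definition blowup (n : int) : utmx := gram n (2 * n) n 3 3 3.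

(** This is [N = M^-1 (M - M^T)] for [M = blowup n], that is, 1 minus the monodromy [M^-1 M^T]. *)
Definition blowup_monodromy (n : int) : 'M[int]_4 :=
  row4 [:: 0; n; 2 * n; n] [:: - n; -9; -15; -6]
       [:: n; 6; 9; 3] [:: - n; -3; -3; 0].

Lemma blowup_monodromyE n :
  (blowup n : 'M_4) *m blowup_monodromy n = (blowup n : 'M_4) - (blowup n : 'M_4)^T.
Proof. by rewrite /blowup_monodromy; row4_ring. Qed.

Lemma blowup_form n :
  ((blowup n : 'M_4) - (blowup n : 'M_4)^T) *m blowup_monodromy n =
  (9 - n ^+ 2) *: (col4 0 1 2 1 *m (col4 0 1 2 1)^T).
Proof.
have -> : (9 - n ^+ 2) *: (col4 0 1 2 1 *m (col4 0 1 2 1)^T) =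
    row4 [:: 0; 0; 0; 0] [:: 0; 9 - n ^+ 2; (9 - n ^+ 2) * 2; 9 - n ^+ 2]
         [:: 0; (9 - n ^+ 2) * 2; (9 - n ^+ 2) * 4; (9 - n ^+ 2) * 2]
         [:: 0; 9 - n ^+ 2; (9 - n ^+ 2) * 2; 9 - n ^+ 2].
  apply/matrixP; do 2!case=> -[|[|[|[|?]]]] // ?;
  by rewrite !mxE big_ord_recl big_ord0 !mxE /=; ring.
by rewrite /blowup_monodromy; row4_ring.
Qed.

(** When [M] becomes [P^T M P], [N] becomes [P^-1 N P], so the form [(M - M^T) N] is pulled back
    along [P]. The entry [(1, 1)] is compared because the linear form [(0, 1, 2, 1)] has coefficient
    1 there. *)
Lemma blowup_orbit_dvd (n m : int) : same_orbit (blowup n) (blowup m) ->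
  exists s, 9 - m ^+ 2 = (9 - n ^+ 2) * s ^+ 2.
Proof.
case/same_orbit_congr => P EP; have uP := congr_utmx_unit EP.
pose u := col4 0 1 2 1; pose A k : 'M[int]_4 := (blowup k : 'M_4) - (blowup k : 'M_4)^T.
have EA : A m = P^T *m A n *m P.
  by rewrite /A EP !trmx_mul trmxK mulmxBr mulmxBl !mulmxA.
have PW : P *m blowup_monodromy m = blowup_monodromy n *m P.
  have uPt : P^T \in unitmx by rewrite unitmx_tr.
  apply: (can_inj (mulKmx (utmx_unit (blowup n)))).
  apply: (can_inj (mulKmx uPt)).
  rewrite !mulmxA -EP blowup_monodromyE -[LHS]/(A m) EA.
  by rewrite /A -blowup_monodromyE !mulmxA.
have AW : A m *m blowup_monodromy m = P^T *m (A n *m blowup_monodromy n) *m P.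
  by rewrite EA -!mulmxA PW.
move: AW; rewrite !blowup_form -/u -scalemxAr -scalemxAl.
have -> : P^T *m (u *m u^T) *m P = (P^T *m u) *m (P^T *m u)^T.
  by rewrite trmx_mul trmxK !mulmxA.
have sq (x : 'cV[int]_4) : (x *m x^T) 1 1 = x 1 0 ^+ 2.
  by rewrite mxE big_ord1 mxE expr2.
move/matrixP/(_ 1 1); rewrite [LHS]mxE [RHS]mxE !sq => E.
exists ((P^T *m u) 1 0); rewrite -E.
by rewrite mxE /= expr1n mulr1.
Qed.

(** Each of [9 - n^2] and [9 - m^2] is a square times the other, so the squares are 1 unless both
    numbers vanish. *)
Lemma blowup_orbit_inj (n m : nat) :
  same_orbit (blowup n%:Z) (blowup m%:Z) -> n = m.
Proof.
move=> nm; have [s E] := blowup_orbit_dvd nm.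
have [s' E'] := blowup_orbit_dvd (same_orbit_sym nm).
suff /eqP : n%:Z ^+ 2 = m%:Z ^+ 2 by rewrite eqrXn2 // => /eqP[].
have [n3|n3] := eqVneq (9 - n%:Z ^+ 2) 0; first by move: E; rewrite n3 mul0r; lia.
have ss : s ^+ 2 * s' ^+ 2 = 1.
  by apply: (mulfI n3); rewrite mulr1 [RHS]E' E; ring.
have s1 : s ^+ 2 = 1.
  move: (sqr_ge0 s) (sqr_ge0 s') ss; move: (s ^+ 2) (s' ^+ 2) => x y x0 y0 xy.
  have y_neq0 : y != 0 by apply: contra_eq_neq xy => ->; rewrite mulr0.
  have y_gt0 : 0 < y by rewrite lt0r y_neq0.
  by nia.
by move: E; rewrite s1 mulr1; lia.
Qed.

(** Divisibility of [M - M^T] by 2 survives congruence; it holds for the quadric, while [blowup n]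
    has entries 3. *)
Lemma quadric_blowup_orbit n : ~ same_orbit (gram 2 2 4 0 2 2) (blowup n).
Proof.
case/same_orbit_congr => P EP.
pose B : 'M[int]_4 := row4 [:: 0; 1; 1; 2] [:: -1; 0; 0; 1]
                           [:: -1; 0; 0; 1] [:: -2; -1; -1; 0].
have EB : (gram 2 2 4 0 2 2 : 'M_4) - (gram 2 2 4 0 2 2 : 'M_4)^T = 2 *: B.
  rewrite /= /gram_mx row4_tr row4_sub.
  by apply/matrixP; do 2!case=> -[|[|[|[|?]]]] // ?; rewrite !mxE.
have : (blowup n : 'M_4) - (blowup n : 'M_4)^T = 2 *: (P^T *m B *m P).
  rewrite scalemxAl scalemxAr -EB EP !trmx_mul trmxK mulmxBr mulmxBl.
  by rewrite !mulmxA.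
move/matrixP/(_ 2 3); rewrite [RHS]mxE.
by rewrite /= /gram_mx row4_tr row4_sub mxE /=; lia.
Qed.

Lemma normal_form_uniq N N' :
  normal_form N -> normal_form N' -> same_orbit N N' -> N = N'.
Proof.
move=> [->|[n ->]] [->|[m ->]] // so.
- by case: (quadric_blowup_orbit so).
- by case: (quadric_blowup_orbit (same_orbit_sym so)).
- by rewrite (blowup_orbit_inj so).
Qed.

Theorem theorem1 (a b c d e f : int)
    (h1 : a * c * d * f - a * b * d - a * c * e - b * c * f - d * e * f
          + a ^+ 2 + b ^+ 2 + c ^+ 2 + d ^+ 2 + e ^+ 2 + f ^+ 2 = 0)
    (h2 : a * f - b * e + c * d = 0)
    (hM : (a, b, c, d, e, f) <> (0, 0, 0, 0, 0, 0)) :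
  exists! N : utmx,
    (N = gram 2 2 4 0 2 2 \/ exists n : nat, N = gram n%:Z (2 * n%:Z) n%:Z 3 3 3) /\
    same_orbit (gram a b c d e f) N.
Proof.
have [r rv] := exists_rank_vector h1 h2 hM.
have [r1 [r2 [r3 [r4 Er]]]] := col4_surj r.
have tr : ranked (a, b, c, d, e, f) (r1, r2, r3, r4) by split=> //; move: rv; rewrite Er.
have [N [nN MN]] := ranked_reducible tr.
exists N; split=> [//|N' [nN' MN']].
exact: normal_form_uniq nN nN' (same_orbit_trans (same_orbit_sym MN) MN').
Qed.
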